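(* Let $p$ be a prime, let $\alpha<\beta<\gamma$ be positive integers, and let $G=\mathbb{Z}/p^{\alpha}\mathbb{Z}\times\mathbb{Z}/p^{\beta}\mathbb{Z}\times\mathbb{Z}/p^{\gamma}\mathbb{Z}$. For $(a,b,c)\in G$ the ideal $[(a,b,c):G]$ is as follows (throughout, when $c\in\mathcal{O}_{\gamma,p^i}$ with the stated range of $i$): (A) Let $a\in\mathcal{O}_{\alpha,p^{\alpha}}$. (A1) For $b\in\mathcal{O}_{\beta,p^{\beta}}$: $[(a,b,c):G]=p^{\gamma}\mathbb{Z}$ for $c\in\mathcal{O}_{\gamma,p^{\gamma}}$; $=p^{\beta}\mathbb{Z}$ for $c\in\mathcal{O}_{\gamma,p^i}$ with $0\le i\le\beta-1$; $=p^{i}\mathbb{Z}$ for $c\in\mathcal{O}_{\gamma,p^i}$ with $\beta\le i\le\gamma-1$. (A2) For $b\in\mathcal{O}_{\beta,p^j}$ with $0\le j\le\beta-1$: $[(a,b,c):G]=p^{\gamma}\mathbb{Z}$ for $c\in\mathcal{O}_{\gamma,p^{\gamma}}$; $=p^{\beta}\mathbb{Z}$ for $c\in\mathcal{O}_{\gamma,p^i}$ with $0\le i\le j$; $=p^{i+\beta-j}\mathbb{Z}$ for $c\in\mathcal{O}_{\gamma,p^i}$ with $j+1\le i\le\gamma-\beta+j$; $=p^{\gamma}\mathbb{Z}$ for $c\in\mathcal{O}_{\gamma,p^i}$ with $\gamma-\beta+j+1\le i\le\gamma-1$. (B) Let $a\in\mathcal{O}_{\alpha,p^k}$ with $0\le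 k\le\alpha-1$. (B1) For $b\in\mathcal{O}_{\beta,p^{\beta}}$: $[(a,b,c):G]=p^{\gamma}\mathbb{Z}$ for $c\in\mathcal{O}_{\gamma,p^{\gamma}}$; $=p^{\beta}\mathbb{Z}$ for $c\in\mathcal{O}_{\gamma,p^i}$ with $0\le i\le\beta-\alpha+k$; $=p^{i+\alpha-k}\mathbb{Z}$ for $c\in\mathcal{O}_{\gamma,p^i}$ with $\beta-\alpha+k+1\le i\le\gamma-\alpha+k-1$; $=p^{\gamma}\mathbb{Z}$ for $c\in\mathcal{O}_{\gamma,p^i}$ with $\gamma-\alpha+k\le i\le\gamma-1$. (B2) For $b\in\mathcal{O}_{\beta,p^j}$ with $0\le j\le\beta-1$: $[(a,b,c):G]=p^{\gamma}\mathbb{Z}$ for $c\in\mathcal{O}_{\gamma,p^{\gamma}}$; $=p^{\beta}\mathbb{Z}$ for $c\in\mathcal{O}_{\gamma,p^i}$ where $i\le j$, $0\le i\le\beta-\alpha$ and $0\le i\le\gamma-\beta+j$; $=p^{\beta+i-j}\mathbb{Z}$ where $i>j$, $0\le i\le\beta-\alpha$ and $0\le i\le\gamma-\beta+j$; $=p^{i+\beta-j}\mathbb{Z}$ where $\gamma-\beta+j\ge i\ge j$, $\beta-\alpha<i$ and $\beta-\alpha>j$; $=p^{\alpha-k+i}\mathbb{Z}$ where $\gamma-\beta+j\ge i\ge j$, $\gamma-\alpha+k>i$ and $j>\beta-\alpha+k$; $=p^{\gamma}\mathbb{Z}$ where $\gamma-\beta+j\ge i\ge j$, $\gamma-\alpha+k\le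 i$ and $j>\beta-\alpha+k$; $=p^{\beta+i-j}\mathbb{Z}$ where $\gamma-\beta+j\ge i\ge j$ and $\beta-\alpha<j\le\beta-\alpha+k$; $=p^{\beta}\mathbb{Z}$ where $i<j$, $\gamma-\beta+j\ge i>\beta-\alpha$ and $j\le\beta-\alpha+k$; $=p^{\beta}\mathbb{Z}$ where $i<j$, $\gamma-\beta+j\ge i$, $\beta-\alpha+k>i>\beta-\alpha$ and $j>\beta-\alpha+k$; $=p^{\alpha+i-k}\mathbb{Z}$ where $i<j$, $\gamma-\beta+j\ge i$ and $\gamma-\alpha+k>i\ge\beta-\alpha+k$; $=p^{\gamma}\mathbb{Z}$ where $i<j$, $\gamma-\beta+j\ge i\ge\gamma-\alpha+k$ and $j>\beta-\alpha+k$; $=p^{\gamma}\mathbb{Z}$ where $\gamma-\beta+j\le i\le\gamma-1$.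
   Context: For a finite abelian group $G$ viewed as a $\mathbb{Z}$-module and $x\in G$, $[x:G]=\{r\in\mathbb{Z} : rG\subseteq\mathbb{Z}x\}$, an ideal of $\mathbb{Z}$. For a positive integer $s$ and $0\le i\le s$, $\mathcal{O}_{s,p^i}=\{p^ib\pmod{p^s} : b\in\mathbb{Z},\ \gcd(b,p)=1\}\subseteq\mathbb{Z}/p^s\mathbb{Z}$; in particular $\mathcal{O}_{s,p^s}=\{0\}$, and these sets partition $\mathbb{Z}/p^s\mathbb{Z}$. *)

(* Defs.v *)
From mathcomp Require Import all_boot all_algebra.
From mathcomp Require Import classical_sets.

Set Implicit Arguments.
Unset Strict Implicit.
Unset Printing Implicit Defensive.

Import GRing.Theory.
Local Open Scope classical_set_scope.
Local Open Scope ring_scope.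

(* The ideal [x : G] of Z; ideals of Z are encoded as sets of int. *)
Definition colon (G : zmodType) (x : G) : set int :=
  [set r : int | range (fun g : G => g *~ r) `<=` range (fun m : int => x *~ m)].

Definition multiples (n : nat) : set int := range (fun m : int => n%:Z * m).

(* O_{s,p^i}, used for p prime, 0 < s and i <= s. The hypothesis 0 < s matters:
   'Z_(p ^ 0) would be Z/2Z. *)
Definition orb (p s i : nat) : set 'Z_(p ^ s) :=
  [set ((p ^ i)%:Z * b)%:~R | b in [set b : int | coprimez b p%:Z]].

Arguments orb : clear implicits.

(* Main.v *)
(* Write x = (p^k u, p^j v, p^i w) with u, v, w coprime to p. An ideal element
   r must send each generator of G into Zx. For the generator of Z/p^gamma this
   requires a multiple m x whose first two entries vanish, i.e. m is divisible
   by p^(alpha - k) and p^(beta - j), so r is divisible by p^(i + beta - j) and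
   p^(i + alpha - k) up to p^gamma. The generator of Z/p^beta forces p^beta to
   divide r (through the previous bound if j <= i, directly if i < j), after
   which the two small generators are killed by r. Hence the ideal is generated
   by p^min(gamma, max(beta, i + beta - j, i + alpha - k)), and every case of the
   theorem evaluates this exponent. *)

Require Import Defs.
From mathcomp Require Import all_boot all_algebra classical_sets.
From mathcomp Require Import zify ring.

Import GRing.Theory.

Section ColonExponent.
Local Open Scope ring_scope.

Lemma intr_Zp_eq0 (q : nat) (z : int) :
  (1 < q)%N -> (z%:~R == 0 :> 'Z_q) = (q %| z)%Z.
Proof.
move=> q_gt1.
have nat_case (n : nat) : (n%:R == 0 :> 'Z_q) = (q %| n)%N.
  by rewrite -val_eqE /= val_Zp_nat.
case: z => n; first exact: nat_case.
by rewrite NegzE rmorphN oppr_eq0 dvdzE abszN; apply: nat_case.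
Qed.

Lemma Zp_intrP (q : nat) (x : 'Z_q) : exists z : int, x = z%:~R.
Proof. by exists (Posz x); rewrite -[LHS]natr_Zp. Qed.

(** The unit [w] cancels by Gauss's lemma and [p ^ i] cancels a power of [p]. For [i > s], truncated
    subtraction makes the right side divisibility by 1. *)
Lemma dvdz_pexpM_coprime (p s i : nat) (w m : int) :
  (0 < p)%N -> coprimez w p ->
  ((p ^ s)%N %| (p ^ i)%:Z * w * m)%Z = ((p ^ (s - i))%N %| m)%Z.
Proof.
move=> p_gt0 cop_wp.
have cop e : coprimez (p ^ e)%N w.
  by rewrite coprimez_sym -natz natrX natz; apply: coprimezXr.
have pn0 e : (p ^ e)%:Z != 0 by rewrite eqz_nat -lt0n expn_gt0 p_gt0.
rewrite -mulrA; case: (leqP i s) => [le_is | /ltnW le_si].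
  rewrite -{1}(subnKC le_is) expnD PoszM dvdz_mul2l ?pn0 //.
  by rewrite Gauss_dvdzr.
rewrite (eqP le_si) expn0 dvd1z; apply: dvdz_mulr.
by rewrite dvdzE dvdn_exp2l.
Qed.

(** Integer representatives replace the residues, so that everything after this is divisibility in
    Z: [r] sends [(x, y, z)] to the multiple of [(a, b, c)] by [m]. *)
Lemma colon_intrP (q1 q2 q3 : nat) (a b c r : int) :
  (1 < q1)%N -> (1 < q2)%N -> (1 < q3)%N ->
  colon (a%:~R : 'Z_q1, b%:~R : 'Z_q2, c%:~R : 'Z_q3) r <->
  forall x y z : int, exists m : int,
    [/\ (q1 %| a * m - x * r)%Z, (q2 %| b * m - y * r)%Z
      & (q3 %| c * m - z * r)%Z].
Proof.
move=> q1_gt1 q2_gt1 q3_gt1.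
have coordE q (u v m : int) : (1 < q)%N ->
    (u%:~R *~ m == v%:~R *~ r :> 'Z_q) = (q %| u * m - v * r)%Z.
  by move=> q_gt1; rewrite -intr_Zp_eq0 // rmorphB -!mulrzA subr_eq0.
have mulzE (U V : zmodType) (x : U) (y : V) n : (x, y) *~ n = (x *~ n, y *~ n).
  rewrite [LHS]surjective_pairing.
  by rewrite (raddfMz (@fst U V)) (raddfMz (@snd U V)).
split=> [colon_r x y z | dvd_r _ [[[u v] w] _ <-]].
  have [|m _] := colon_r ((x%:~R, y%:~R, z%:~R) *~ r).
    by exists (x%:~R, y%:~R, z%:~R).
  rewrite /= !mulzE => -[/eqP + /eqP + /eqP].
  by rewrite !coordE //; exists m.
have [x ->] := Zp_intrP q1 u; have [y ->] := Zp_intrP q2 v.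
have [z ->] := Zp_intrP q3 w.
have [m [dx dy dz]] := dvd_r x y z; exists m => //.
by rewrite !mulzE; congr (_, _, _); apply/eqP; rewrite coordE.
Qed.

(* The exponents [i], [j], [k] are not bounded: truncated subtraction gives the
   right value when they exceed those of the factors. *)
Lemma colon_orb (p alpha beta gamma i j k : nat)
    (a : 'Z_(p ^ alpha)) (b : 'Z_(p ^ beta)) (c : 'Z_(p ^ gamma)) :
  (1 < p)%N -> (0 < alpha)%N -> (alpha <= beta)%N -> (beta <= gamma)%N ->
  a \in orb p alpha k -> b \in orb p beta j -> c \in orb p gamma i ->
  let e := maxn beta (i + maxn (beta - j) (alpha - k)) in
  colon (a, b, c) = multiples (p ^ minn gamma e).
Proof.
move=> p_gt1 alpha_gt0 le_ab le_bg.
move=> /set_mem[u cop_u <-] /set_mem[v cop_v <-] /set_mem[w cop_w <-] e.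
have p_gt0 : (0 < p)%N by apply: ltnW.
have q_gt1 s : (0 < s)%N -> (1 < p ^ s)%N.
  by move=> s_gt0; rewrite -{1}(expn0 p) ltn_exp2l.
have dvd_le s t (m : int) :
    (s <= t)%N -> ((p ^ t)%N %| m)%Z -> ((p ^ s)%N %| m)%Z.
  by move=> le_st; apply: dvdz_trans; rewrite dvdzE dvdn_exp2l.
have colonP := colon_intrP (p ^ alpha) (p ^ beta) (p ^ gamma) _ _ _ _
  (q_gt1 _ alpha_gt0) (q_gt1 beta ltac:(lia)) (q_gt1 gamma ltac:(lia)).
apply/seteqP; split=> r.
  move/colonP => colon_r.
  (* Test on [(0, 0, 1)]: the vanishing first two entries make [p ^ s] divide [m], and [r] agrees
     with [p ^ i * w * m] modulo [p ^ gamma]. Leaving [s] free allows [s = beta - j] below. *)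
  have dvd_r3 s : (s <= maxn (beta - j) (alpha - k))%N ->
      ((p ^ minn gamma (i + s))%N %| r)%Z.
    have [m [da db dc]] := colon_r 0 0 1; move=> le_s.
    move: da db; rewrite !mul0r !subr0 !dvdz_pexpM_coprime // => da db.
    rewrite mul1r in dc.
    rewrite -(rpredBl (x := (p ^ i)%:Z * w * m)).
      by apply: dvd_le dc; apply: geq_minl.
    rewrite dvdz_pexpM_coprime //.
    case: (leqP s (beta - j)) => [le_sb | lt_sb].
      by apply: dvd_le db; lia.
    by apply: dvd_le da; lia.
  (* If [i < j], test on [(0, 1, 0)]: the vanishing third entry makes [p ^ (gamma - i)] divide [m],
     and [gamma - i >= beta - j], so [p ^ beta] divides [p ^ j * v * m]. *)
  have dvd_r2 : ((p ^ beta)%N %| r)%Z.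
    case: (leqP j i) => [le_ji | lt_ij].
      by apply: dvd_le (dvd_r3 (beta - j)%N _); lia.
    have [m [_ db dc]] := colon_r 0 1 0.
    move: dc; rewrite mul0r subr0 dvdz_pexpM_coprime // => dc.
    rewrite mul1r in db; rewrite -(rpredBl (x := (p ^ j)%:Z * v * m)) //.
    by rewrite dvdz_pexpM_coprime //; apply: dvd_le dc; lia.
  have : ((p ^ minn gamma e)%N %| r)%Z.
    rewrite /e; set s := maxn (beta - j) _.
    case: (leqP (i + s) beta) => [le_sb | lt_sb].
      by rewrite (minn_idPr le_bg).
    exact: dvd_r3.
  by case/dvdzP=> m ->; exists m => //; apply: mulrC.
move=> [r' _ <-]; apply/colonP => x y z.
have le_be : (beta <= e)%N by apply: leq_maxl.
(* A multiple of [p ^ beta] annihilates the first two factors, so there only the multiple of [a] or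
   [b] has to vanish. *)
have kill s d (m t : int) :
    (s <= beta)%N -> (beta <= d)%N -> ((p ^ s)%N %| m)%Z ->
    ((p ^ s)%N %| m - t * ((p ^ d)%:Z * r'))%Z.
  move=> le_sb le_bd dm; rewrite rpredBl //.
  by rewrite dvdz_mull // dvdz_mulr // dvdzE dvdn_exp2l // (leq_trans le_sb).
(* If [gamma <= e], then [r] annihilates the whole group and [m = 0] serves. *)
case: (leqP gamma e) => [le_ge | lt_eg].
  exists 0; rewrite !mulr0; split; try by apply: kill; rewrite ?dvdz0.
  by rewrite sub0r rpredN dvdz_mull // dvdz_mulr.
have [[w' t] /= inv_w] : exists wt, wt.1 * w + wt.2 * (p ^ gamma)%:Z = 1.
  apply/coprimezP; rewrite -natz natrX natz; exact: coprimezXr.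
(* As [w'] inverts [w] modulo [p ^ gamma], this [m] solves [c * m = z * r] in the third factor. It
   kills [a] and [b] because [e - i] is at least [alpha - k] and [beta - j]. *)
exists ((p ^ (e - i))%:Z * w' * r' * z); split.
- apply: kill => //; rewrite dvdz_pexpM_coprime // -!mulrA dvdz_mulr //.
  by rewrite dvdzE dvdn_exp2l //; lia.
- apply: kill => //; rewrite dvdz_pexpM_coprime // -!mulrA dvdz_mulr //.
  by rewrite dvdzE dvdn_exp2l //; lia.
(* The difference is [p ^ e * z * r' * (w' * w - 1)], and [w' * w - 1] equals [- t * p ^ gamma]. *)
apply/dvdzP; exists (- (p ^ e)%:Z * z * r' * t).
have -> : (p ^ e)%:Z = (p ^ i)%:Z * (p ^ (e - i))%:Z.
  by rewrite -PoszM -expnD subnKC //; lia.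
rewrite -[X in _ - X]mulr1 -inv_w.
ring.
Qed.
End ColonExponent.
Theorem theorem3 (p alpha beta gamma : nat)
    (p_prime : prime p) (alpha_gt0 : 0 < alpha)
    (lt_alpha_beta : alpha < beta) (lt_beta_gamma : beta < gamma)
    (a : 'Z_(p ^ alpha)) (b : 'Z_(p ^ beta)) (c : 'Z_(p ^ gamma)) :
  (* (A) *)
  (a \in orb p alpha alpha ->
    (* (A1) *)
    (b \in orb p beta beta ->
      (c \in orb p gamma gamma -> colon (a, b, c) = multiples (p ^ gamma))
      /\ (forall i, c \in orb p gamma i ->
        (i <= beta - 1 -> colon (a, b, c) = multiples (p ^ beta))
        /\ (beta <= i <= gamma - 1 -> colon (a, b, c) = multiples (p ^ i))))
    /\
    (* (A2) *)
    (forall j, j <= beta - 1 -> b \in orb p beta j ->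
      (c \in orb p gamma gamma -> colon (a, b, c) = multiples (p ^ gamma))
      /\ (forall i, c \in orb p gamma i ->
        (i <= j -> colon (a, b, c) = multiples (p ^ beta))
        /\ (j + 1 <= i <= gamma - beta + j ->
             colon (a, b, c) = multiples (p ^ (i + beta - j)))
        /\ (gamma - beta + j + 1 <= i <= gamma - 1 ->
             colon (a, b, c) = multiples (p ^ gamma)))))
  /\
  (* (B) *)
  (forall k, k <= alpha - 1 -> a \in orb p alpha k ->
    (* (B1) *)
    (b \in orb p beta beta ->
      (c \in orb p gamma gamma -> colon (a, b, c) = multiples (p ^ gamma))
      /\ (forall i, c \in orb p gamma i ->
        (i <= beta - alpha + k -> colon (a, b, c) = multiples (p ^ beta))
        /\ (beta - alpha + k + 1 <= i <= gamma - alpha + k - 1 ->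
             colon (a, b, c) = multiples (p ^ (i + alpha - k)))
        /\ (gamma - alpha + k <= i <= gamma - 1 ->
             colon (a, b, c) = multiples (p ^ gamma))))
    /\
    (* (B2) *)
    (forall j, j <= beta - 1 -> b \in orb p beta j ->
      (c \in orb p gamma gamma -> colon (a, b, c) = multiples (p ^ gamma))
      /\ (forall i, c \in orb p gamma i ->
        (i <= j -> i <= beta - alpha -> i <= gamma - beta + j ->
             colon (a, b, c) = multiples (p ^ beta))
        /\ (i > j -> i <= beta - alpha -> i <= gamma - beta + j ->
             colon (a, b, c) = multiples (p ^ (beta + i - j)))
        /\ (j <= i <= gamma - beta + j -> beta - alpha < i ->
            j < beta - alpha ->
             colon (a, b, c) = multiples (p ^ (i + beta - j)))
        /\ (j <= i <= gamma - beta + j -> i < gamma - alpha + k ->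
            j > beta - alpha + k ->
             colon (a, b, c) = multiples (p ^ (alpha - k + i)))
        /\ (j <= i <= gamma - beta + j -> gamma - alpha + k <= i ->
            j > beta - alpha + k ->
             colon (a, b, c) = multiples (p ^ gamma))
        /\ (j <= i <= gamma - beta + j -> beta - alpha < j <= beta - alpha + k ->
             colon (a, b, c) = multiples (p ^ (beta + i - j)))
        /\ (i < j -> beta - alpha < i <= gamma - beta + j ->
            j <= beta - alpha + k ->
             colon (a, b, c) = multiples (p ^ beta))
        /\ (i < j -> i <= gamma - beta + j ->
            beta - alpha < i < beta - alpha + k -> j > beta - alpha + k ->
             colon (a, b, c) = multiples (p ^ beta))
        /\ (i < j -> i <= gamma - beta + j ->
            beta - alpha + k <= i < gamma - alpha + k ->
             colon (a, b, c) = multiples (p ^ (alpha + i - k)))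
        /\ (i < j -> gamma - alpha + k <= i <= gamma - beta + j ->
            j > beta - alpha + k ->
             colon (a, b, c) = multiples (p ^ gamma))
        /\ (gamma - beta + j <= i <= gamma - 1 ->
             colon (a, b, c) = multiples (p ^ gamma))))).
Proof.
have p_gt1 := prime_gt1 p_prime.
(* With the exponent [n] tied only by an equation, every case becomes linear arithmetic with [minn]
   and [maxn]; zero entries are the cases [k = alpha], [j = beta], [i = gamma]. *)
have colonE i j k :
    a \in orb p alpha k -> b \in orb p beta j -> c \in orb p gamma i ->
    forall n, n = minn gamma (maxn beta (i + maxn (beta - j) (alpha - k))) ->
    colon (a, b, c) = multiples (p ^ n).
  move=> ha hb hc n ->.
  exact: (colon_orb _ _ _ _ _ _ _ _ _ _ p_gt1 alpha_gt0 (ltnW lt_alpha_beta)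
    (ltnW lt_beta_gamma) ha hb hc).
split=> [ha | k le_k ha]; split=> [hb | j le_j hb]; split=> [hc | i hc];
  repeat split; intros; apply: (colonE _ _ _ ha hb hc);
  clear p_prime p_gt1 colonE ha hb hc a b c; lia.
Qed.
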